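(* Let $p, q$ be distinct primes and let $G$ be a solvable by finite group. If $G$ is a residually finite $p$-group and a residually finite $q$-group, then $G$ has a (finite) series \[ 1 = G_0 \lhd G_1 \lhd \dots \lhd G_n = G \] with $G_i \lhd G$ for all $i$ and $G_{i+1}/G_i$ torsion free abelian for all $i$ (with $0 \le i < n$). In particular $G$ is right orderable.
   Context: A group $G$ is solvable by finite if it has a normal solvable subgroup of finite index. For a prime $p$, a group $G$ is a residually finite $p$-group if for every nonidentity element $g \in G$ there is a normal subgroup $N$ of $G$ with $g \notin N$ such that $G/N$ is a finite $p$-group (i.e. $N$ has finite index equal to a power of $p$). A group $G$ is right orderable if it has a total ordering $\le$ such that $x \le y$ implies $xg \le yg$ for all $g, x, y \in G$. The notation $K \lhd L$ means that $K$ is a normal subgroup of $L$ (not necessarily proper). *)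

(* Defs.v *)
(* Possibly infinite groups are [groupType]s, and subsets are
   [set]s from mathcomp-classical.  The choice structure carried by a
   [groupType] is no restriction, since it exists classically on any type. *)
From HB Require Import structures.
From mathcomp Require Import all_boot.
From mathcomp Require Import boolp classical_sets cardinality.

Set Implicit Arguments.
Unset Strict Implicit.
Unset Printing Implicit Defensive.

Local Open Scope classical_set_scope.
Local Open Scope card_scope.
Local Open Scope group_scope.

Section Subgroups.
Variable G : groupType.
Implicit Types (H K L A B : set G) (x y : G).

Record is_subgroup H : Prop := IsSubgroup {
  subgroup1 : H 1;
  subgroupM : forall x y, H x -> H y -> H (x * y);
  subgroupV : forall x, H x -> H x^-1 }.

Record is_normal K L : Prop := IsNormal {
  normal_sub : is_subgroup K;
  normal_over : is_subgroup L;
  normal_le : K `<=` L;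
  normalJ : forall x y, K x -> L y -> K (x ^ y) }.

Definition left_coset x K : set G := [set x * k | k in K].

Definition set_mul A B : set G := [set a * b | a in A & b in B].

Definition set_inv A : set G := [set a^-1 | a in A].

Definition is_coset_of K L A : Prop := exists2 x, L x & A = left_coset x K.

(* The quotient L / K: its elements are the cosets of K in L, multiplied and
   inverted as subsets of G.  The normality proof is a parameter because the
   group structure below depends on it. *)
Record quotient_group K L (nKL : is_normal K L) := Coset {
  coset_set : set G;
  coset_setP : is_coset_of K L coset_set }.

End Subgroups.

HB.instance Definition _ (G : groupType) (K L : set G) (nKL : is_normal K L) :=
  gen_eqMixin (quotient_group nKL).
HB.instance Definition _ (G : groupType) (K L : set G) (nKL : is_normal K L) :=
  gen_choiceMixin (quotient_group nKL).

Section QuotientGroup.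
Variables (G : groupType) (K L : set G) (nKL : is_normal K L).
Local Notation Q := (quotient_group nKL).
Implicit Types A B C : Q.

Let K1 : K 1 := subgroup1 (normal_sub nKL).
Let KM := subgroupM (normal_sub nKL).
Let KV := subgroupV (normal_sub nKL).
Let L1 : L 1 := subgroup1 (normal_over nKL).
Let LM := subgroupM (normal_over nKL).
Let LV := subgroupV (normal_over nKL).
Let KJ := normalJ nKL.

Lemma coset_set_inj : injective (@coset_set _ _ _ nKL).
Proof.
move=> [A PA] [B PB] /= eAB; subst B; congr Coset; exact: Prop_irrelevance.
Qed.

Lemma set_mul_coset x y : L x -> L y ->
  set_mul (left_coset x K) (left_coset y K) = left_coset (x * y) K.
Proof.
move=> Lx Ly; apply/seteqP; split=> [_ [_ [k Kk <-] [_ [l Kl <-] <-]]|_ [k Kk <-]].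
  exists (k ^ y * l); first by apply: KM => //; exact: KJ.
  by rewrite /conjg !mulgA mulgK.
by exists (x * 1); [exists 1|exists (y * k); [exists k|rewrite mulg1 mulgA]].
Qed.

Lemma set_inv_coset x : L x -> set_inv (left_coset x K) = left_coset x^-1 K.
Proof.
move=> Lx; apply/seteqP; split=> [_ [_ [k Kk <-] <-]|_ [k Kk <-]].
  exists (k^-1 ^ x^-1); first by apply: KJ; [exact: KV|exact: LV].
  by rewrite /conjg invgK invgM !mulgA mulVg mul1g.
exists (x * (k^-1 ^ x)); first by exists (k^-1 ^ x) => //; apply: KJ => //; exact: KV.
by rewrite /conjg mulgA mulgV mul1g invgM invgK.
Qed.

Let coset1 : K = left_coset 1 K.
Proof.
apply/seteqP; split=> [k Kk|_ [k Kk <-]]; last by rewrite mul1g.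
by exists k; rewrite ?mul1g.
Qed.

Fact quotient_oneP : is_coset_of K L K.
Proof.
by exists 1.
Qed.

Fact quotient_mulP A B : is_coset_of K L (set_mul (coset_set A) (coset_set B)).
Proof.
have [[x Lx ->] [y Ly ->]] := (coset_setP A, coset_setP B).
by exists (x * y); [exact: LM|exact: set_mul_coset].
Qed.

Fact quotient_invP A : is_coset_of K L (set_inv (coset_set A)).
Proof.
have [x Lx ->] := coset_setP A.
by exists x^-1; [exact: LV|exact: set_inv_coset].
Qed.

Definition quotient_one : Q := Coset nKL quotient_oneP.
Definition quotient_mul A B : Q := Coset nKL (quotient_mulP A B).
Definition quotient_inv A : Q := Coset nKL (quotient_invP A).

Fact quotient_mulA : associative quotient_mul.
Proof.
move=> A B C; apply: coset_set_inj => /=.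
have [[x Lx ->] [y Ly ->]] := (coset_setP A, coset_setP B).
have [z Lz ->] := coset_setP C.
by rewrite !set_mul_coset ?mulgA //; exact: LM.
Qed.

Fact quotient_mul1 : left_id quotient_one quotient_mul.
Proof.
move=> A; apply: coset_set_inj => /=; have [x Lx ->] := coset_setP A.
by rewrite {1}coset1 set_mul_coset // mul1g.
Qed.

Fact quotient_mulr1 : right_id quotient_one quotient_mul.
Proof.
move=> A; apply: coset_set_inj => /=; have [x Lx ->] := coset_setP A.
by rewrite {2}coset1 set_mul_coset // mulg1.
Qed.

Fact quotient_mulV : left_inverse quotient_one quotient_inv quotient_mul.
Proof.
move=> A; apply: coset_set_inj => /=; have [x Lx ->] := coset_setP A.
by rewrite set_inv_coset // set_mul_coset ?mulVg -?coset1 //; exact: LV.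
Qed.

Fact quotient_mulrV : right_inverse quotient_one quotient_inv quotient_mul.
Proof.
move=> A; apply: coset_set_inj => /=; have [x Lx ->] := coset_setP A.
by rewrite set_inv_coset // set_mul_coset ?mulgV -?coset1 //; exact: LV.
Qed.

HB.instance Definition _ := isGroup.Build Q
  quotient_mulA quotient_mul1 quotient_mulr1 quotient_mulV quotient_mulrV.

End QuotientGroup.

Definition abelian_group (Q : groupType) : Prop := forall x y : Q, commute x y.

Definition torsion_free (Q : groupType) : Prop :=
  forall (x : Q) (n : nat), (0 < n)%N -> x ^+ n = 1 -> x = 1.

Definition finite_group (Q : groupType) : Prop := finite_set [set: Q].

Definition finite_pgroup (p : nat) (Q : groupType) : Prop :=
  exists k : nat, [set: Q] #= `I_(p ^ k)%N.

(* S is solvable when it has a finite subnormal series with abelian factors;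
   only the terms H 0, ..., H n of the sequence H matter. *)
Definition solvable_subgroup (G : groupType) (S : set G) : Prop :=
  exists (n : nat) (H : nat -> set G),
    [/\ H 0%N = [set 1], H n = S
      & forall i, (i < n)%N ->
          exists nH : is_normal (H i) (H i.+1), abelian_group (quotient_group nH)].

Definition solvable_by_finite (G : groupType) : Prop :=
  exists (S : set G) (nS : is_normal S [set: G]),
    solvable_subgroup S /\ finite_group (quotient_group nS).

Definition residually_finite_pgroup (p : nat) (G : groupType) : Prop :=
  forall g : G, g <> 1 ->
    exists (N : set G) (nN : is_normal N [set: G]),
      ~ N g /\ finite_pgroup p (quotient_group nN).

Definition right_orderable (G : groupType) : Prop :=
  exists le : rel G,
    [/\ reflexive le, antisymmetric le, transitive le, total le
      & forall g x y : G, le x y -> le (x * g) (y * g)].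

(* Main.v *)
(* Work relative to a normal subgroup B such that G/B is residually a finite
   p-group and a finite q-group; then G/B is torsion free.  If A is normal in G
   and [A, A] <= B, let C/B be the centralizer of AB/B in G/B and D/B that of
   C/B.  Quotients of G/B by centralizers of normal subgroups inherit both
   residual properties, since the centralizer of the image of A in a finite
   p-quotient of G/B is normal there.  As A <= C, we get D <= C, so D/B is
   abelian; moreover it contains AB/B.  Applying this to the normal cores in G of
   the terms of a subnormal abelian series of the solvable subgroup S, we climb
   from 1 to a normal subgroup containing S, with torsion free quotient; the
   latter is also finite, so that subgroup is G.  Torsion free abelian groups are
   orderable by Zorn's lemma, and the orders of the factors of a series are
   glued lexicographically. *)
From HB Require Import structures.
From mathcomp Require Import fingroup.
Require Import Defs.
From mathcomp Require Import all_boot.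
From mathcomp Require Import boolp classical_sets cardinality.
Local Open Scope classical_set_scope.
Local Open Scope group_scope.

(** Lagrange's theorem, borrowed from finite group theory: the bijection with [I_m] makes [Q] a
    [finGroupType] with [m] elements. *)
Lemma expg_card (Q : groupType) (m : nat) (x : Q) :
  ([set: Q] #= `I_m)%card -> x ^+ m = 1.
Proof.
move=> /card_set_bijP[f [ffun finj fsurj]].
have /choice[g gP] : forall i : 'I_m, exists y : Q, f y = i.
  by move=> i; have [y _ fy] := fsurj i (ltn_ord i); exists y.
have fm y : (f y < m)%N by apply: ffun.
pose F y := Ordinal (fm y).
have FK : cancel F g by move=> y; apply: finj; rewrite ?inE ?gP.
have gK : cancel g F by move=> i; apply: val_inj; rewrite /= gP.
have finQ : Finite.axiom (codom g).
  move=> y; rewrite count_uniq_mem; first by rewrite -(FK y) codom_f.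
  by rewrite map_inj_uniq -?enumT ?enum_uniq //; exact: can_inj gK.
pose cntM := CanIsCountable FK.
pose finM := isFinite.Build Q finQ.
pose fQ : finGroupType := HB.pack Q cntM finM.
have cardQ : #|fQ| = m.
  by rewrite -[RHS]card_ord; apply: (bij_eq_card (f := F : fQ -> _)); exists g.
have := cardSg (finset.subsetT <[x : fQ]>).
rewrite cardsT cardQ => /dvdnP[k ->].
by rewrite mulnC expgnA (expg_order (x : fQ)) expg1n.
Qed.

(** * Computing in quotient groups through representatives *)

Section Cosets.
Context {G : groupType}.
Implicit Types (K L : set G) (x y : G).

Lemma subgroupX {K x} n : is_subgroup K -> K x -> K (x ^+ n).
Proof.
move=> sK Kx; elim: n => [|n IHn]; first by rewrite expg0; exact: subgroup1.
by rewrite expgS; exact: subgroupM.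
Qed.

Lemma left_coset_eq K x y : is_subgroup K ->
  left_coset x K = left_coset y K <-> K (y^-1 * x).
Proof.
move=> sK; split=> [exy|Kyx].
  have : left_coset x K x by exists 1; [exact: subgroup1|rewrite mulg1].
  by rewrite exy => -[k Kk <-]; rewrite mulKg.
apply/seteqP; split=> [_ [k Kk <-]|_ [k Kk <-]].
  exists ((y^-1 * x) * k); first exact: subgroupM.
  by rewrite !mulgA mulgV mul1g.
exists ((y^-1 * x)^-1 * k); first by apply: subgroupM => //; exact: subgroupV.
by rewrite invgM invgK !mulgA mulgV mul1g.
Qed.

Context {K L : set G} {nKL : is_normal K L}.
Local Notation Q := (quotient_group nKL).
Implicit Types X Y : Q.

Definition represents X x : Prop := L x /\ coset_set X = left_coset x K.

Lemma represents_exl X : exists x, represents X x.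
Proof. by have [x Lx eX] := coset_setP X; exists x. Qed.

Lemma represents_exr x : L x -> exists X, represents X x.
Proof. by move=> Lx; exists (Coset nKL (ex_intro2 _ _ x Lx erefl)). Qed.

Lemma represents_eq X Y x y : represents X x -> represents Y y ->
  X = Y <-> K (y^-1 * x).
Proof.
move=> [Lx eX] [Ly eY].
have := left_coset_eq K x y (normal_sub nKL); rewrite -eX -eY => -[eK Ke].
by split=> [XY|/Ke/coset_set_inj//]; apply: eK; rewrite XY.
Qed.

Lemma represents1 : represents 1 1.
Proof.
split; first exact: subgroup1 (normal_over nKL).
apply/seteqP; split=> [k Kk|_ [k Kk <-]]; last by rewrite mul1g.
by exists k; rewrite ?mul1g.
Qed.

Lemma represents_eq1 X x : represents X x -> X = 1 <-> K x.
Proof.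
by move=> Xx; have := represents_eq _ _ _ _ Xx represents1; rewrite invg1 mul1g.
Qed.

Lemma representsM X Y x y :
  represents X x -> represents Y y -> represents (X * Y) (x * y).
Proof.
move=> [Lx eX] [Ly eY]; split; first exact: subgroupM (normal_over nKL) _ _ Lx Ly.
by rewrite -(set_mul_coset nKL) // -eX -eY.
Qed.

Lemma representsV X x : represents X x -> represents X^-1 x^-1.
Proof.
move=> [Lx eX]; split; first exact: subgroupV (normal_over nKL) _ Lx.
by rewrite -(set_inv_coset nKL) // -eX.
Qed.

Lemma representsX X x n : represents X x -> represents (X ^+ n) (x ^+ n).
Proof.
move=> Xx; elim: n => [|n IHn]; first by rewrite !expg0; exact: represents1.
by rewrite !expgS; exact: representsM.
Qed.

Lemma abelian_quotientP :
  abelian_group Q <-> forall x y, L x -> L y -> K [~ x, y].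
Proof.
have E x y : (y * x)^-1 * (x * y) = [~ x, y].
  by rewrite /commg /conjg invgM !mulgA.
split=> [abQ x y Lx Ly|KL X Y].
  have [[X Xx] [Y Yy]] := (represents_exr x Lx, represents_exr y Ly).
  have := represents_eq _ _ _ _ (representsM _ _ _ _ Xx Yy) (representsM _ _ _ _ Yy Xx).
  by rewrite E => <-; exact: abQ.
have [[x Xx] [y Yy]] := (represents_exl X, represents_exl Y).
apply/(represents_eq _ _ _ _ (representsM _ _ _ _ Xx Yy) (representsM _ _ _ _ Yy Xx)).
by rewrite E; apply: KL; [case: Xx|case: Yy].
Qed.

Lemma torsion_free_quotientP :
  torsion_free Q <-> forall x n, L x -> (0 < n)%N -> K (x ^+ n) -> K x.
Proof.
split=> [tfQ x n Lx n0 Kxn|KL X n n0].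
  have [X Xx] := represents_exr x Lx.
  apply/(represents_eq1 _ _ Xx)/(tfQ _ n n0).
  exact/(represents_eq1 _ _ (representsX _ _ n Xx)).
have [x Xx] := represents_exl X.
move=> /(represents_eq1 _ _ (representsX _ _ n Xx)) Kxn.
by apply/(represents_eq1 _ _ Xx)/(KL _ n) => //; case: Xx.
Qed.

Lemma expg_card_quotient m x :
  ([set: Q] #= `I_m)%card -> L x -> K (x ^+ m).
Proof.
move=> cQ /represents_exr[X Xx].
apply/(represents_eq1 _ _ (representsX _ _ m Xx)).
exact: expg_card.
Qed.

End Cosets.

(** * Centralizers modulo a normal subgroup and residual properties *)

Section CentralizerModulo.
Context {G : groupType}.
Implicit Types (A B K N : set G) (x y a : G).

Lemma normalTP K : is_normal K [set: G] <->
  is_subgroup K /\ forall x y, K x -> K (x ^ y).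
Proof.
split=> [nK|[sK KJ]]; first by split=> [|x y Kx]; [case: nK|exact: normalJ nK _ _ Kx I].
by split=> // x y Kx _; exact: KJ.
Qed.

Lemma normal_commg K x y : is_normal K [set: G] -> K x -> K [~ x, y].
Proof.
by move=> nK Kx; rewrite commgEl; apply: subgroupM (normal_sub nK) _ _ _ _;
  [exact: subgroupV (normal_sub nK) _ Kx|exact: normalJ nK _ _ Kx I].
Qed.

(** For [B] normal in [G], the preimage in [G] of the centralizer of the image of [A] in [G/B];
    staying inside [G] avoids iterated quotients. *)
Definition centralizer_mod B A : set G := [set x | forall a, A a -> B [~ x, a]].

Lemma centralizer_mod_sub B A :
  is_normal B [set: G] -> B `<=` centralizer_mod B A.
Proof. by move=> nB x Bx a _; exact: normal_commg. Qed.

Lemma centralizer_modS B B' A :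
  B `<=` B' -> centralizer_mod B A `<=` centralizer_mod B' A.
Proof. by move=> sBB x Bx a Aa; exact/sBB/Bx. Qed.

Lemma centralizer_mod_sym B A K :
  is_subgroup B -> A `<=` centralizer_mod B K -> K `<=` centralizer_mod B A.
Proof. by move=> sB AK x Kx a Aa; rewrite -invgR; apply: subgroupV sB _ _; exact: AK. Qed.

Lemma centralizer_mod_normal B A :
  is_normal B [set: G] -> is_normal A [set: G] ->
  is_normal (centralizer_mod B A) [set: G].
Proof.
move=> nB nA; have [sB BJ] := (normalTP B).1 nB; have [_ AJ] := (normalTP A).1 nA.
apply/normalTP; split; first split.
- by move=> a _; rewrite commgEl conj1g invg1 mul1g; exact: subgroup1.
- move=> x y Cx Cy a Aa; have -> : [~ x * y, a] = [~ x, a] ^ y * [~ y, a].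
    by rewrite /commg /conjg !invgM !mulgA !mulgK.
  by apply: subgroupM => //; [apply/BJ/Cx|exact: Cy].
- move=> x Cx a Aa; have -> : [~ x^-1, a] = ([~ x, a]^-1) ^ x^-1.
    by rewrite /commg /conjg !invgM !invgK !mulgA ?mulgK.
  by apply: BJ; apply: (subgroupV sB); exact: Cx.
- move=> x y Cx a Aa; rewrite -[a](conjgKV y) -conjRg.
  by apply/BJ/Cx/AJ.
Qed.

(* Only the exponents of the elements of G/N matter, so finiteness of G/N is
   weakened to being a torsion p-group. *)
Definition residually_torsion_pgroup (p : nat) B : Prop :=
  forall x, ~ B x -> exists N : set G,
    [/\ is_normal N [set: G], B `<=` N, ~ N x & forall y, exists k, N (y ^+ (p ^ k)%N)].

(** If [x, a] lies outside [B], choose [N] avoiding it: the centralizer of [A] modulo [N] omits [x],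
    and it contains [N], so exponents remain powers of [p]. *)
Lemma residually_torsion_pgroup_centralizer p B A :
  is_normal B [set: G] -> is_normal A [set: G] ->
  residually_torsion_pgroup p B ->
  residually_torsion_pgroup p (centralizer_mod B A).
Proof.
move=> nB nA rB x /existsNP[a /not_implyP[Aa /rB[N [nN BN Nxa Np]]]].
exists (centralizer_mod N A); split; first exact: centralizer_mod_normal.
- exact: centralizer_modS.
- by move=> /(_ _ Aa).
- by move=> y; have [k Nyk] := Np y; exists k; exact: centralizer_mod_sub.
Qed.

(** The image of [x] in [G/N] has order dividing both [n] and a power of [p], hence is trivial. *)
Lemma residually_torsion_pgroup_coprime {p B x n} : prime p -> coprime p n ->
  residually_torsion_pgroup p B -> B (x ^+ n) -> B x.
Proof.
move=> pp cpn rB Bxn; apply: contrapT => /rB[N [nN BN Nx Np]]; apply: Nx.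
have [sN _] := (normalTP N).1 nN; have [k Nxk] := Np x.
have pk0 : (0 < p ^ k)%N by rewrite expn_gt0 prime_gt0.
have /eqP := coprimeXl k cpn.
(* Bezout without subtraction: u * p^k = v * n + 1. *)
case: (egcdnP n pk0) => u v e _ /[dup] g1 _.
have : N (x ^+ (u * p ^ k)) by rewrite mulnC expgnA; exact: subgroupX.
rewrite e g1 expgnDr expg1.
have Nv : N (x ^+ (v * n)) by rewrite mulnC expgnA; apply: subgroupX => //; exact: BN.
by move=> /(subgroupM sN (subgroupV sN Nv)); rewrite mulKg.
Qed.

(** Write [n] as m * p^k with [m] prime to [p]: the residual property at [p] removes [m], the one at
    [q] removes p^k. *)
Lemma residually_pq_torsion_free {p q B x n} : prime p -> prime q -> p <> q ->
  residually_torsion_pgroup p B -> residually_torsion_pgroup q B ->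
  (0 < n)%N -> B (x ^+ n) -> B x.
Proof.
move=> pp pq /eqP npq rp rq n0; have [m cpm ->] := pfactor_coprime pp n0.
rewrite mulnC expgnA => /(residually_torsion_pgroup_coprime pp cpm rp).
apply: (residually_torsion_pgroup_coprime pq _ rq).
by rewrite coprimeXr // prime_coprime // dvdn_prime2 // eq_sym.
Qed.

Definition double_centralizer_mod B A := centralizer_mod B (centralizer_mod B A).

Lemma double_centralizer_mod_abelian B A x y :
  is_subgroup B -> A `<=` centralizer_mod B A ->
  double_centralizer_mod B A x -> double_centralizer_mod B A y -> B [~ x, y].
Proof. by move=> sB sAC Dx Dy; apply: Dx => a Aa; exact/Dy/sAC. Qed.

(** Terms of a subnormal series need not be normal in [G]; the intersections of their conjugates
    are. *)
Definition normal_core K : set G := [set x | forall g, K (x ^ g)].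

Lemma normal_core_normal K : is_subgroup K -> is_normal (normal_core K) [set: G].
Proof.
move=> sK; apply/normalTP; split; last by move=> x y Kx g; rewrite -conjgM.
split=> [g|x y Kx Ky g|x Kx g]; first by rewrite conj1g; exact: subgroup1.
- by rewrite conjMg; exact: subgroupM.
- by rewrite conjVg; exact: subgroupV.
Qed.

Lemma normal_core_id K : is_normal K [set: G] -> normal_core K = K.
Proof.
move=> nK; apply/seteqP; split=> x Kx; first by rewrite -[x]conjg1; exact: Kx.
by move=> g; exact: normalJ nK _ _ Kx I.
Qed.

End CentralizerModulo.

(** * Positive cones, orders on abelian groups and lexicographic gluing *)

Section Cones.

(** Meant as the elements above 1 in a one-sided invariant total order on the subgroup [L]. *)
Definition positive_cone (G : groupType) (P L : set G) : Prop :=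
  [/\ P `<=` L, ~ P 1, (forall x y, P x -> P y -> P (x * y))
    & forall x, L x -> [\/ x = 1, P x | P x^-1]].

(** Zorn's lemma gives a maximal subsemigroup avoiding 1; maximality forces it to be a cone. *)
Lemma abelian_positive_cone (G : groupType) : abelian_group G -> torsion_free G ->
  exists P : set G, positive_cone G P [set: G].
Proof.
move=> abG tfG.
pose good (P : set G) := ~ P 1 /\ forall x y, P x -> P y -> P (x * y).
have [|P [[P1 PM] maxP]] := Zorn_bigcup (P := good).
  move=> F Fgood Ftot; split=> [[X /Fgood[X1 _]]//|x y [X FX Xx] [Y FY Yy]].
  have [XY|YX] := Ftot _ _ FX FY.
  - by exists Y => //; apply: (Fgood _ FY).2 => //; exact: XY.
  - by exists X => //; apply: (Fgood _ FX).2 => //; exact: YX.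
have PX z n : P z -> (0 < n)%N -> P (z ^+ n).
  move=> Pz; elim: n => // -[|n] IHn _; first by rewrite expg1.
  by rewrite expgS; apply: PM => //; exact: IHn.
(* If neither P nor x generates a larger semigroup avoiding 1, then x has a
   negative power in P or finite order. *)
have key x : x <> 1 -> ~ P x -> exists2 n, (0 < n)%N & P (x ^- n).
  move=> x1 nPx; apply: contrapT => nex.
  (* The semigroup generated by [P] and [x]; pure powers of [x] are a separate case because 1 is not
     in [P]. *)
  pose P' := [set z | P z \/ exists2 n, (0 < n)%N &
    z = x ^+ n \/ exists2 u, P u & z = u * x ^+ n].
  apply: (maxP P').
    by split=> [z Pz|/(_ x) sP']; [left|apply/nPx/sP'; right; exists 1%N => //; left].
  split=> [[//|[n n0 [xn|[u Pu /esym un]]]]|].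
  - by apply: x1; apply: tfG n0 _.
  - by apply: nex; exists n => //; rewrite -(mulgK (x ^+ n) u) un mul1g in Pu.
  have cx u n : x ^+ n * u = u * x ^+ n by exact: abG.
  move=> y z [Py|[n n0 Hy]] [Pz|[m m0 Hz]].
  - by left; exact: PM.
  - right; exists m => //; right.
    by case: Hz => [->|[u Pu ->]]; [exists y|exists (y * u); [exact: PM|rewrite mulgA]].
  - right; exists n => //; right.
    case: Hy => [->|[u Pu ->]]; first by exists z.
    by exists (u * z); [exact: PM|rewrite -!mulgA cx].
  - right; exists (n + m)%N; first by rewrite addn_gt0 n0.
    case: Hy Hz => [->|[u Pu ->]] [->|[v Pv ->]]; rewrite expgnDr.
    + by left.
    + by right; exists v => //; rewrite mulgA cx mulgA.
    + by right; exists u => //; rewrite mulgA.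
    + right; exists (u * v); first exact: PM.
      by rewrite -!mulgA; congr (_ * _); rewrite !mulgA cx.
exists P; split=> // x _; have [x1|x1] := pselect (x = 1); first exact: Or31.
have [Px|nPx] := pselect (P x); first exact: Or32.
have [Pxv|nPxv] := pselect (P x^-1); first exact: Or33.
have [n n0 Pn] := key _ x1 nPx.
have [|m m0] := key x^-1 _ nPxv; first by move=> /(congr1 inv); rewrite invgK invg1.
(* Now x^-n and x^m lie in [P], hence so do x^(mn) and its inverse, whose product is 1. *)
rewrite -expVgn invgK => Pm; case: P1.
rewrite -(mulgV (x ^+ (m * n))) expgnA; apply: PM; first exact: PX.
by rewrite -expgnA mulnC expgnA -expVgn; exact: PX.
Qed.

(** Lexicographic order: the coset decides outside [K], and [P] decides within [K]. *)
Lemma positive_cone_extension (G : groupType) (K L P : set G)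
    (nKL : is_normal K L) (PQ : set (quotient_group nKL)) :
  positive_cone G P K -> positive_cone _ PQ [set: _] ->
  exists P', positive_cone G P' L.
Proof.
move=> [PK P1 PM Ptot] [_ Q1 QM Qtot].
pose R := [set x | exists2 X, represents X x & PQ X].
have RL : R `<=` L by move=> x [X []].
(* Multiplying by an element of [P] leaves the coset unchanged, so mixed products stay in [R]. *)
have inK x : P x -> represents (1 : quotient_group nKL) x.
  move=> /PK Kx; have [X Xx] := represents_exr (nKL := nKL) x (normal_le nKL Kx).
  by rewrite -((represents_eq1 _ _ Xx).2 Kx).
exists (P `|` R); split.
- by move=> x [/PK|/RL //]; exact: normal_le nKL x.
- move=> [//|[X X1 QX]]; apply: Q1; rewrite -((represents_eq1 _ _ X1).2 _) //.
  exact: subgroup1 (normal_sub nKL).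
- move=> x y [Px|[X Xx QX]] [Py|[Y Yy QY]].
  + by left; exact: PM.
  + by right; exists Y => //; rewrite -[Y]mul1g; apply: representsM => //; exact: inK.
  + by right; exists X => //; rewrite -[X]mulg1; apply: representsM => //; exact: inK.
  + by right; exists (X * Y); [exact: representsM|exact: QM].
- move=> x Lx; have [X Xx] := represents_exr (nKL := nKL) x Lx.
  have [X1|QX|QX] := Qtot X I.
  + have /Ptot[->|Px|Px] := (represents_eq1 _ _ Xx).1 X1; first exact: Or31.
    * by apply: Or32; left.
    * by apply: Or33; left.
  + by apply: Or32; right; exists X.
  + by apply: Or33; right; exists X^-1 => //; exact: representsV.
Qed.

Lemma positive_cone_right_orderable (G : groupType) (P : set G) :
  positive_cone G P [set: G] -> right_orderable G.
Proof.
move=> [_ P1 PM Ptot].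
(* Right multiplication of both arguments by [g] cancels in y * x^-1. *)
exists (fun x y => `[< x = y \/ P (y * x^-1) >]); split.
- by move=> x; apply/asboolP; left.
- move=> x y /andP[/asboolP[//|Pyx] /asboolP[//|Pxy]]; case: P1.
  by have := PM _ _ Pyx Pxy; rewrite mulgA mulgKV mulgV.
- move=> y x z /asboolP[->//|Pyx] /asboolP[<-|Pzy]; apply/asboolP; right=> //.
  by have := PM _ _ Pzy Pyx; rewrite mulgA mulgKV.
- move=> x y; apply/orP; have [yx|Pyx|Pyx] := Ptot (y * x^-1) I.
  + by left; apply/asboolP; left; rewrite -(mulgKV x y) yx mul1g.
  + by left; apply/asboolP; right.
  + by right; apply/asboolP; right; rewrite invgM invgK in Pyx.
- move=> g x y /asboolP[->|Pyx]; apply/asboolP; [by left|right].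
  by rewrite invgM mulgA mulgK.
Qed.

End Cones.

(** * The series of double centralizers and the theorem *)

Lemma residually_finite_pgroup_torsion p (G : groupType) :
  residually_finite_pgroup p G -> residually_torsion_pgroup p [set (1 : G)].
Proof.
move=> rG x /rG[N [nN [Nx [k cN]]]]; exists N; split=> //.
  by move=> _ ->; exact: subgroup1 (normal_sub nN).
by move=> y; exists k; exact: expg_card_quotient cN I.
Qed.

Lemma positive_cone_series (G : groupType) (n : nat) (H : nat -> set G) :
  H 0%N = [set 1] ->
  (forall i, (i < n)%N -> exists nH : is_normal (H i) (H i.+1),
     torsion_free (quotient_group nH) /\ abelian_group (quotient_group nH)) ->
  exists P, positive_cone G P (H n).
Proof.
move=> H0; elim: n => [|n IHn] Hq.
  (* The trivial subgroup has the empty cone. *)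
  by rewrite H0; exists set0; split=> // x ->; exact: Or31.
have [P Pn] := IHn (fun i ltin => Hq i (ltnW ltin)).
have [nH [tfQ abQ]] := Hq n (ltnSn n).
have [PQ QP] := abelian_positive_cone _ abQ tfQ.
exact: positive_cone_extension Pn QP.
Qed.

Theorem theorem2 (p q : nat) (G : groupType) :
  prime p -> prime q -> p <> q ->
  solvable_by_finite G ->
  residually_finite_pgroup p G -> residually_finite_pgroup q G ->
  (exists (n : nat) (H : nat -> set G),
     [/\ H 0%N = [set 1],
         H n = [set: G],
         (forall i : nat, (i <= n)%N -> is_normal (H i) [set: G])
       & (forall i : nat, (i < n)%N ->
            exists nH : is_normal (H i) (H i.+1),
              torsion_free (quotient_group nH) /\
              abelian_group (quotient_group nH))])
  /\ right_orderable G.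
Proof.
move=> pp pq npq [S [nS [[n [H [H0 HS Hab]]] [m cm]]]] rp rq.
suff [n' [K [K0 KT Kn Kq]]] : exists (n : nat) (H : nat -> set G),
     [/\ H 0%N = [set 1],
         H n = [set: G],
         (forall i : nat, (i <= n)%N -> is_normal (H i) [set: G])
       & (forall i : nat, (i < n)%N ->
            exists nH : is_normal (H i) (H i.+1),
              torsion_free (quotient_group nH) /\
              abelian_group (quotient_group nH))].
  split; first by exists n', K.
  have [P] := positive_cone_series _ _ _ K0 Kq.
  by rewrite KT; exact: positive_cone_right_orderable.
have m0 : (0 < m)%N.
  by case: m cm => // /card_set_bijP[f [/(_ 1 I)]].
(* As [S] is normal, [K n] is [S] itself. *)
pose K i := normal_core (H i).
have nK i : (i <= n)%N -> is_normal (K i) [set: G].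
  move=> lein; apply: normal_core_normal; case: (ltnP i n) => [/Hab[nH _]|leni].
    exact: normal_sub nH.
  have -> : i = n by apply/eqP; rewrite eqn_leq lein.
  by rewrite HS; exact: normal_sub nS.
have Kab i x y : (i < n)%N -> K i.+1 x -> K i.+1 y -> K i [~ x, y].
  move=> /Hab[nH /abelian_quotientP HC] Kx Ky g.
  by rewrite conjRg; apply: HC; [exact: Kx|exact: Ky].
pose B := fix B i : set G :=
  if i is j.+1 then double_centralizer_mod (B j) (K j.+1) else [set 1].
(* Commutators of elements of [K i.+1] lie in [K i], hence in [B i]. *)
have sKB i : (i < n)%N -> is_normal (B i) [set: G] -> K i `<=` B i ->
    K i.+1 `<=` centralizer_mod (B i) (K i.+1).
  by move=> ltin nB KB x Kx y Ky; apply/KB/Kab.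
have HB i : (i <= n)%N -> [/\ is_normal (B i) [set: G],
    residually_torsion_pgroup p (B i), residually_torsion_pgroup q (B i)
    & K i `<=` B i].
  elim: i => [_|i IHi ltin].
    split; try exact: residually_finite_pgroup_torsion.
      apply/normalTP; split; last by move=> _ y ->; rewrite conj1g.
      by split=> // [_ _ -> ->|_ ->]; rewrite ?mulg1 ?invg1.
    by move=> x /(_ 1); rewrite H0 conjg1.
  have [nB rBp rBq KB] := IHi (ltnW ltin).
  (* [B i.+1] is the centralizer of this normal subgroup, so it inherits normality and both residual
     properties. *)
  have nC := centralizer_mod_normal _ _ nB (nK _ ltin).
  split; [exact: centralizer_mod_normal|exact: residually_torsion_pgroup_centralizer
    |exact: residually_torsion_pgroup_centralizer|].
  (* Any set lies in its own double centralizer. *)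
  exact: centralizer_mod_sym (normal_sub nB) _.
exists n, B; split=> // [|i lein|i ltin].
- apply/seteqP; split=> // x _; have [_ rBp rBq KB] := HB n (leqnn n).
  (* With [m] the index of [S], x^m lies in [S], hence in [B n], and [G] modulo [B n] is torsion
     free. *)
  apply: (residually_pq_torsion_free pp pq npq rBp rBq m0); apply: KB.
  by rewrite /K HS normal_core_id //; exact: expg_card_quotient cm I.
- by have [] := HB i lein.
- have [nB rBp rBq KB] := HB i (ltnW ltin).
  have [/normalTP[sB' _] _ _ _] := HB i.+1 ltin.
  have nBB : is_normal (B i) (B i.+1).
    have [sB BJ] := (normalTP _).1 nB.
    by split=> // [|x y Bx _]; [exact: centralizer_mod_sub|exact: BJ].
  exists nBB; split.
    by apply/torsion_free_quotientP => x k _; exact: (residually_pq_torsion_free pp pq npq rBp rBq).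
  apply/abelian_quotientP => x y; apply: double_centralizer_mod_abelian.
    exact: normal_sub nB.
  exact: sKB.
Qed.
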